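(* Let $\alpha,\beta\ge 0$ with $(\alpha,\beta)\neq(0,0)$, and let $\mathbf{T}=(T_1,\dots,T_n)\in\mathcal{B}_{A^{1/2}}(\mathcal{H})^n$. Then: (i) $\sqrt{\alpha+\beta}\;\omega_A(\mathbf{T})\le\|\mathbf{T}\|_{A_{\alpha,\beta}}\le\sqrt{\alpha+4\beta n}\;\omega_A(\mathbf{T})$. (ii) $\max\Big\{\sqrt{\beta},\ \tfrac12\sqrt{\tfrac{\alpha+\beta}{n}}\Big\}\|\mathbf{T}\|_A\le\|\mathbf{T}\|_{A_{\alpha,\beta}}\le\sqrt{\alpha+\beta}\;\|\mathbf{T}\|_A$.
   Context: $\mathcal{H}$ is a non-trivial complex Hilbert space, $\mathcal{B}(\mathcal{H})$ the bounded linear operators on it, $A\in\mathcal{B}(\mathcal{H})$ a fixed positive operator ($\langle Ax,x\rangle\ge0$ for all $x$), $n\ge 1$ an integer. Put $\langle x,y\rangle_A=\langle Ax,y\rangle$ and $\|x\|_A=\langle Ax,x\rangle^{1/2}$. $\mathcal{B}_{A^{1/2}}(\mathcal{H})$ is the set of $T\in\mathcal{B}(\mathcal{H})$ for which there is $c>0$ with $\|Tx\|_A\le c\|x\|_A$ for all $x\in\mathcal{H}$; $\mathcal{B}_{A^{1/2}}(\mathcal{H})^n$ is the set of $n$-tuples of such operators. For $\mathbf{T}\in\mathcal{B}_{A^{1/2}}(\mathcal{H})^n$, $$\|\mathbf{T}\|_{A_{\alpha,\beta}}=\sup_{\|x\|_A=1}\Big(\sum_{k=1}^n\big(\alpha|\langle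 T_kx,x\rangle_A|^2+\beta\|T_kx\|_A^2\big)\Big)^{1/2},$$ $$\|\mathbf{T}\|_A=\sup_{\|x\|_A=1}\Big(\sum_{k=1}^n\|T_kx\|_A^2\Big)^{1/2},\qquad \omega_A(\mathbf{T})=\sup_{\|x\|_A=1}\Big(\sum_{k=1}^n|\langle T_kx,x\rangle_A|^2\Big)^{1/2}.$$ *)

(* Defs.v *)
From HB Require Import structures.
From mathcomp Require Import all_boot all_order all_algebra.
From mathcomp Require Import complex.
From mathcomp Require Import all_classical all_reals all_analysis.

Set Implicit Arguments.
Unset Strict Implicit.
Unset Printing Implicit Defensive.

Import Order.TTheory GRing.Theory Num.Theory Num.Def.
Import numFieldNormedType.Exports.

Local Open Scope ring_scope.
Local Open Scope complex_scope.
Local Open Scope classical_set_scope.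

Section SemiHilbert.
Context (R : realType) (H : completeNormedModType R[i]).

(* A complex Hilbert space is a complete normed space over [R[i]] whose norm
   comes from an inner product, linear in its first argument. *)
Definition induces_norm (dot : {dot H for conjC}) : Prop :=
  forall x : H, `|x| ^+ 2 = dot x x.

Definition bounded_operator (T : {linear H -> H}) : Prop :=
  exists M : R, forall x : H, `|T x| <= M%:C * `|x|.

Variable dot : {dot H for conjC}.

(* [0 <= z] in [R[i]] says that [z] is real and nonnegative. *)
Definition positive_operator (A : {linear H -> H}) : Prop :=
  forall x : H, 0 <= dot (A x) x.

Variable A : {linear H -> H}.

Definition A_dot (x y : H) : R[i] := dot (A x) y.

Definition A_norm (x : H) : R := Num.sqrt (complex.Re (A_dot x x)).

(* Membership in B_{A^(1/2)}(H). *)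
Definition A_bounded (T : {linear H -> H}) : Prop :=
  bounded_operator T /\
  exists2 c : R, 0 < c & forall x : H, A_norm (T x) <= c * A_norm x.

Definition A_sphere : set H := [set x | A_norm x = 1].

(* If [A = 0] the A-sphere is empty and, as [sup set0 = 0], the three suprema
   below are [0]; otherwise they range over a nonempty set, which is bounded
   above as soon as the [T k] are A-bounded and [A] is positive. *)

Definition A_alpha_beta_norm (alpha beta : R) (n : nat)
    (T : 'I_n -> {linear H -> H}) : R :=
  sup [set Num.sqrt (\sum_(k < n)
             (alpha * ComplexField.Normc.normc (A_dot (T k x) x) ^+ 2
              + beta * A_norm (T k x) ^+ 2)) | x in A_sphere].

Definition A_joint_norm (n : nat) (T : 'I_n -> {linear H -> H}) : R :=
  sup [set Num.sqrt (\sum_(k < n) A_norm (T k x) ^+ 2) | x in A_sphere].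

Definition A_joint_numerical_radius (n : nat)
    (T : 'I_n -> {linear H -> H}) : R :=
  sup [set Num.sqrt (\sum_(k < n)
             ComplexField.Normc.normc (A_dot (T k x) x) ^+ 2) | x in A_sphere].

End SemiHilbert.

(* Main.v *)
(** Everything reduces to the two pointwise bounds, for [‖x‖_A = 1],
    [∑ |<T_k x, x>_A|^2 <= ∑ ‖T_k x‖_A^2 <= 4 n ω_A(T)^2].  The first is the
    Cauchy-Schwarz inequality for the semi-inner product [<., .>_A].  For the
    second, [|<T_k z, z>_A| <= w ‖z‖_A^2] with [w = ω_A(T)] holds for all [z]
    (Cauchy-Schwarz covers [‖z‖_A = 0]), so polarization and the parallelogram
    identity give [|<T_k x, y>_A| <= w (‖x‖_A^2 + ‖y‖_A^2)]; taking
    [y = T_k x / (2 w)] yields [‖T_k x‖_A^2 <= 4 w^2 ‖x‖_A^2]. *)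
Require Import Defs.
From HB Require Import structures.
From mathcomp Require Import all_boot all_order all_algebra.
From mathcomp Require Import complex ring.
From mathcomp Require Import all_classical all_reals all_analysis.

Import Order.TTheory GRing.Theory Num.Theory Num.Def.
Import numFieldNormedType.Exports.
Local Open Scope ring_scope.

(** * Positive semidefinite sesquilinear forms *)

Section SemiInnerProduct.
Context (C : numClosedFieldType) (V : lmodType C) (s : V -> V -> C).
Context (s_linl : forall a x y z, s (a *: x + y) z = a * s x z + s y z)
  (s_linr : forall a x y z, s z (a *: x + y) = a^* * s z x + s z y)
  (s_ge0 : forall x, 0 <= s x x).

Lemma semi_dot_expand a x y :
  s (a *: x + y) (a *: x + y)
  = a * a^* * s x x + a * s x y + a^* * s y x + s y y.
Proof. by rewrite s_linl !s_linr; ring. Qed.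

(* Positivity makes [s x y + s y x] and [i (s x y - s y x)] real. *)
Lemma semi_dotC x y : (s y x)^* = s x y.
Proof.
have real_cross a : a * s x y + a^* * s y x \is Num.real.
  have -> : a * s x y + a^* * s y x
      = s (a *: x + y) (a *: x + y) - (a * a^* * s x x + s y y).
    by rewrite semi_dot_expand; ring.
  by rewrite rpredB ?rpredD ?ger0_real // mulr_ge0 // mul_conjC_ge0.
have /CrealP := real_cross 1; have /CrealP := real_cross 'i.
rewrite !rmorphD !rmorphM /= !conjCK conjCi conjC1 !mul1r.
set a := s x y; set b := s y x => h1 h2.
have h3 : b^* - a^* = a - b.
  by apply: (mulfI (neq0Ci C)); rewrite !mulrBr -!mulNr addrC.
suff h : b^* *+ 2 = a *+ 2 by apply: (pmulrnI (ltn0Sn 1)).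
have -> : b^* *+ 2 = (a^* + b^*) + (b^* - a^*) by ring.
by rewrite h2 h3; ring.
Qed.

Lemma semi_CauchySchwarz x y : `|s x y| ^+ 2 <= s x x * s y y.
Proof.
have nz u v : s u u != 0 -> `|s u v| ^+ 2 <= s u u * s v v.
  move=> nz0; have u_gt0 : 0 < s u u by rewrite lt0r nz0 s_ge0.
  (* This coefficient minimizes the form along the line through [v] in direction [u]. *)
  have := s_ge0 ((- (s v u / s u u)) *: u + v).
  rewrite semi_dot_expand normCK semi_dotC.
  rewrite rmorphN rmorphM /= fmorphV /= !semi_dotC.
  have -> : - (s v u / s u u) * - (s u v / s u u) * s u u +
     - (s v u / s u u) * s u v + - (s u v / s u u) * s v u + s v v
     = s v v - s u v * s v u / s u u by field.
  by rewrite subr_ge0 ler_pdivrMr // [X in _ <= X]mulrC.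
have [x0|/nz//] := eqVneq (s x x) 0.
have [y0|/nz] := eqVneq (s y y) 0; last first.
  by move=> /(_ x); rewrite mulrC -[s y x]semi_dotC norm_conjC.
(* Both vectors are isotropic, so only the cross terms survive: the form here equals -2 |s x y|^2,
   which positivity forces to vanish. *)
have := s_ge0 ((- s y x) *: x + y).
rewrite semi_dot_expand x0 y0 rmorphN /= normCK !semi_dotC.
rewrite mulr0 add0r addr0 mul0r !mulNr.
by rewrite [s x y * _]mulrC -opprD oppr_ge0 -mulr2n pmulrn_lle0.
Qed.

Context (T : {linear V -> V}).

Lemma polarization x y :
  4 * s (T x) y = s (T (1 *: y + x)) (1 *: y + x)
    - s (T ((-1) *: y + x)) ((-1) *: y + x)
    + 'i * s (T ('i *: y + x)) ('i *: y + x)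
    - 'i * s (T ((- 'i) *: y + x)) ((- 'i) *: y + x).
Proof.
rewrite !(linearD T) !(linearZ_LR T) !s_linl !s_linr !rmorphN /= conjCi conjC1.
have e' : ('i : C) ^+ 2 = -1 by rewrite sqrCi.
by ring: e'.
Qed.

(** The four vectors are those of [polarization]; the cross terms cancel because 1, -1, i and -i sum
    to 0. *)
Lemma parallelogram x y :
  s (1 *: y + x) (1 *: y + x) + s ((-1) *: y + x) ((-1) *: y + x)
  + s ('i *: y + x) ('i *: y + x) + s ((- 'i) *: y + x) ((- 'i) *: y + x)
  = 4 * (s x x + s y y).
Proof.
rewrite !semi_dot_expand !rmorphN /= conjCi conjC1.
have e' : ('i : C) ^+ 2 = -1 by rewrite sqrCi.
by ring: e'.
Qed.

Lemma semi_dot_le_radius w x y :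
  (forall z, `|s (T z) z| <= w * s z z) ->
  `|s (T x) y| <= w * (s x x + s y y).
Proof.
move=> Tw.
(* After scaling by 4, the right side is [w] times four squares, matched one by one with the terms
   of [polarization]. *)
rewrite -(ler_pM2l (ltr0n C 4)) mulrCA -parallelogram.
rewrite -[X in X * `|_|](ger0_norm (ler0n C 4)) -normrM polarization.
do 3 rewrite mulrDr.
apply: le_trans (ler_normB _ _) _; rewrite normrM normCi mul1r.
apply: lerD (Tw _).
apply: le_trans (ler_normD _ _) _; rewrite normrM normCi mul1r.
apply: lerD (Tw _).
apply: le_trans (ler_normB _ _) _; exact: lerD.
Qed.

Lemma semi_norm_le_radius w x : 0 <= w ->
  (forall z, `|s (T z) z| <= w * s z z) ->
  s (T x) (T x) <= 4 * w ^+ 2 * s x x.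
Proof.
move=> w0 Tw; set Q := s (T x) (T x).
have Q0 : 0 <= Q by exact: s_ge0.
have [w_eq0|w_neq0] := eqVneq w 0.
  have := semi_dot_le_radius _ x (T x) Tw.
  by rewrite -/Q w_eq0 mul0r expr0n mulr0 mul0r ger0_norm.
have w_gt0 : 0 < w by rewrite lt0r w_neq0.
(* Pairing [T x] with [t *: T x] gives t Q <= w (s x x + t^2 Q); this [t] maximizes t - w t^2, the
   resulting factor of Q. *)
pose t := (2 * w)^-1.
have t0 : 0 < t by rewrite invr_gt0 mulr_gt0 // ltr0n.
have ct : t^* = t by apply/CrealP/gtr0_real.
have s0r z : s z 0 = 0.
  by have := s_linr (-1) 0 0 z; rewrite scaler0 addr0 rmorphN /= conjC1 mulN1r addNr.
have s0l z : s 0 z = 0.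
  by have := s_linl (-1) 0 0 z; rewrite scaler0 addr0 mulN1r addNr.
(* The summand 0 gives the vector the shape expected by [s_linr] and [semi_dot_expand]. *)
have := semi_dot_le_radius _ x (t *: T x + 0) Tw.
rewrite s_linr semi_dot_expand ct !s0l !s0r !mulr0 !addr0 -/Q.
rewrite ger0_norm ?mulr_ge0 ?(ltW t0) // => h.
have w2 : 0 < 4 * w by rewrite mulr_gt0 // ltr0n.
move: h; rewrite -(ler_pM2l w2) => h.
have e1 : 4 * w * (t * Q) = Q + Q by rewrite /t; field.
have e2 : 4 * w * (w * (s x x + t * t * Q)) = 4 * w ^+ 2 * s x x + Q.
  by rewrite /t; field.
by move: h; rewrite e1 e2 lerD2r.
Qed.

End SemiInnerProduct.

(** * Suprema of real functions over a possibly empty set *)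

Section SupOfImages.
Local Open Scope classical_set_scope.
Context (R : realType) (U : Type) (S : set U).

(** [0 <= b] covers the empty set, whose [sup] is 0. *)
Lemma sup_image_le (f : U -> R) b :
  0 <= b -> (forall x, S x -> f x <= b) -> sup [set f x | x in S] <= b.
Proof.
move=> b0 fb; have [->|/set0P[x Sx]] := eqVneq S set0.
  by rewrite image_set0 sup0.
by apply: ge_sup; [exists (f x), x | move=> _ [y Sy <-]; exact: fb].
Qed.

Lemma le_sup_image (f : U -> R) x :
  has_ubound [set f x | x in S] -> S x -> f x <= sup [set f x | x in S].
Proof. by move=> fS Sx; apply: ub_le_sup => //; exists x. Qed.

(** [sup] defaults to 0 on empty and on unbounded images. *)
Lemma sup_image_ge0 (f : U -> R) :
  (forall x, 0 <= f x) -> 0 <= sup [set f x | x in S].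
Proof.
move=> f0; have [->|/set0P[x Sx]] := eqVneq S set0.
  by rewrite image_set0 sup0.
have [fS|nfS] := pselect (has_ubound [set f x | x in S]); last first.
  by rewrite sup_out // => -[].
by apply: le_trans (f0 x) _; exact: le_sup_image.
Qed.

Lemma mul_sup_image_le (f : U -> R) a b :
  0 <= a -> 0 <= b -> (forall x, S x -> a * f x <= b) ->
  a * sup [set f x | x in S] <= b.
Proof.
move=> a0 b0 fb; have [a_eq0|a_neq0] := eqVneq a 0; first by rewrite a_eq0 mul0r.
have a_gt0 : 0 < a by rewrite lt0r a_neq0.
rewrite -ler_pdivlMl //; apply: sup_image_le => [|x Sx].
  by rewrite mulr_ge0 // invr_ge0.
by rewrite ler_pdivlMl // fb.
Qed.

End SupOfImages.

(** * Transfer to the A-semi-inner product, with real-valued norms *)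

Lemma normr_normc (R : rcfType) (z : R[i]) :
  `|z| = (ComplexField.Normc.normc z)%:C%C.
Proof. by []. Qed.

Lemma normc_ge0 (R : rcfType) (z : R[i]) : 0 <= ComplexField.Normc.normc z.
Proof. by rewrite -ler0c -normr_normc. Qed.

Section SemiHilbertSpace.
Local Open Scope complex_scope.
Context (R : realType) (H : completeNormedModType R[i])
  (dot : {dot H for conjC}) (A : {linear H -> H}).
Context (HApos : positive_operator dot A).
Local Notation normc := ComplexField.Normc.normc.
Local Notation "<< x , y >>" := (A_dot dot A x y).
Local Notation "N[ x ]" := (A_norm dot A x).

Lemma A_dot_linl (a : R[i]) x y z : << a *: x + y, z >> = a * << x, z >> + << y, z >>.
Proof. by rewrite /A_dot linearP linearDl linearZl_LR. Qed.

Lemma A_dot_linr (a : R[i]) x y z :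
  << z, a *: x + y >> = conjC a * << z, x >> + << z, y >>.
Proof. by rewrite /A_dot linearDr linearZr_LR. Qed.

Lemma A_norm_ge0 x : 0 <= N[x].
Proof. exact: sqrtr_ge0. Qed.

(** Positivity of [A] makes the imaginary part 0 and the real part nonnegative, so squaring the root
    recovers the value. *)
Lemma A_dotxx x : << x, x >> = (N[x] ^+ 2)%:C.
Proof.
have := HApos x; rewrite -/(A_dot dot A x x) /A_norm.
case: (A_dot dot A x x) => re im; rewrite lecE /= => /andP[/eqP -> re0].
by rewrite sqr_sqrtr.
Qed.

Lemma A_CauchySchwarz x y : normc << x, y >> <= N[x] * N[y].
Proof.
have := @semi_CauchySchwarz _ H (A_dot dot A) A_dot_linl A_dot_linr HApos x y.
rewrite !A_dotxx normr_normc -rmorphXn -rmorphM lecR -exprMn.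
by rewrite ler_pXn2r ?nnegrE ?mulr_ge0 ?A_norm_ge0 ?normc_ge0.
Qed.

Lemma A_dotZ (r : R) x y : << r%:C *: x, r%:C *: y >> = (r ^+ 2)%:C * << x, y >>.
Proof.
rewrite /A_dot (linearZ_LR A) linearZl_LR linearZr_LR /= mulrA.
(* The conjugation coming from the second argument is convertible to [conjc], which fixes real
   scalars. *)
by rewrite -[X in _ * X * _]/(conjc _) conjc_real -rmorphM -expr2.
Qed.

Lemma A_normZ (r : R) x : 0 <= r -> N[r%:C *: x] = r * N[x].
Proof.
move=> r0; rewrite {1}/A_norm A_dotZ A_dotxx -rmorphM /= -exprMn.
by rewrite sqrtr_sqr ger0_norm // mulr_ge0 // A_norm_ge0.
Qed.

Context (T : {linear H -> H}).

Lemma A_numerical_radius_homogeneous w :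
  (forall x, A_sphere dot A x -> normc << T x, x >> <= w) ->
  forall x, normc << T x, x >> <= w * N[x] ^+ 2.
Proof.
move=> Tw x; have [x0|x_neq0] := eqVneq (N[x]) 0.
  rewrite x0 expr0n mulr0; apply: le_trans (A_CauchySchwarz _ _) _.
  by rewrite x0 mulr0.
have x_gt0 : 0 < N[x] by rewrite lt0r x_neq0 A_norm_ge0.
have /Tw : A_sphere dot A ((N[x]^-1)%:C *: x).
  by rewrite /A_sphere /= A_normZ ?invr_ge0 ?A_norm_ge0 // mulVf.
rewrite (linearZ_LR T) A_dotZ ComplexField.Normc.normcM.
have -> : normc (N[x]^-1 ^+ 2)%:C = N[x]^-1 ^+ 2.
  by apply: complexI; rewrite -normr_normc ger0_norm // ler0c sqr_ge0.
by rewrite exprVn ler_pdivrMl ?exprn_gt0 // mulrC.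
Qed.

Lemma A_norm_le_radius w x : 0 <= w ->
  (forall x, A_sphere dot A x -> normc << T x, x >> <= w) ->
  N[T x] ^+ 2 <= 4 * w ^+ 2 * N[x] ^+ 2.
Proof.
move=> w0 /A_numerical_radius_homogeneous Tw.
have := @semi_norm_le_radius _ H (A_dot dot A) A_dot_linl A_dot_linr HApos T w%:C x.
rewrite ler0c !A_dotxx => /(_ w0).
have -> : 4 * w%:C ^+ 2 * (N[x] ^+ 2)%:C = (4 * w ^+ 2 * N[x] ^+ 2)%:C.
  by rewrite -(rmorph_nat (real_complex R) 4) -rmorphXn -!rmorphM.
rewrite lecR; apply => z.
by rewrite A_dotxx normr_normc -rmorphM lecR.
Qed.

End SemiHilbertSpace.

(** * Comparison of the three joint quantities *)

Theorem theorem3p5 (R : realType) (H : completeNormedModType R[i])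
    (dot : {dot H for conjC}) (Hdot : induces_norm dot)
    (Hnontrivial : exists x : H, x != 0)
    (A : {linear H -> H}) (HA : bounded_operator A)
    (HApos : positive_operator dot A)
    (n : nat) (Hn : (1 <= n)%N)
    (T : 'I_n -> {linear H -> H}) (HT : forall k, A_bounded dot A (T k))
    (alpha beta : R) (Halpha : 0 <= alpha) (Hbeta : 0 <= beta)
    (Hab : (alpha, beta) != (0, 0)) :
  (Num.sqrt (alpha + beta) * A_joint_numerical_radius dot A T
     <= A_alpha_beta_norm dot A alpha beta T
     <= Num.sqrt (alpha + 4 * beta * n%:R) * A_joint_numerical_radius dot A T)
  /\
  (Num.max (Num.sqrt beta) (2^-1 * Num.sqrt ((alpha + beta) / n%:R))
       * A_joint_norm dot A T
     <= A_alpha_beta_norm dot A alpha beta T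
     <= Num.sqrt (alpha + beta) * A_joint_norm dot A T).
Proof.
pose S := A_sphere dot A.
(* [p], [m] and [g] are the squares of the functions under the three suprema; on the sphere (alpha +
   beta) p <= g <= (alpha + beta) m. *)
pose p x := \sum_(k < n) ComplexField.Normc.normc (A_dot dot A (T k x) x) ^+ 2.
pose m x := \sum_(k < n) A_norm dot A (T k x) ^+ 2.
pose g x := alpha * p x + beta * m x.
have p0 x : 0 <= p x by apply: sumr_ge0 => k _; exact: sqr_ge0.
have m0 x : 0 <= m x by apply: sumr_ge0 => k _; exact: sqr_ge0.
have ab0 : 0 <= alpha + beta by rewrite addr_ge0.
have n_gt0 : (0 : R) < n%:R by rewrite ltr0n.
have pm x : S x -> p x <= m x.
  move=> Sx; apply: ler_sum => k _.
  rewrite ler_pXn2r ?nnegrE ?A_norm_ge0 ?normc_ge0 //.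
  by apply: le_trans (A_CauchySchwarz _ _ _ _ HApos _ _) _; rewrite Sx mulr1.
have gm x : S x -> g x <= (alpha + beta) * m x.
  by move=> Sx; rewrite mulrDl lerD2r ler_wpM2l // pm.
have pg x : S x -> (alpha + beta) * p x <= g x.
  by move=> Sx; rewrite mulrDl lerD2l ler_wpM2l // pm.
(* A-boundedness of each [T k] bounds [m], hence also [p] and [g], so all three suprema are genuine
   upper bounds. *)
have [B mB] : exists B, forall x, S x -> m x <= B.
  have /boolp.choice[c Tc] k : exists c, forall x, S x ->
      A_norm dot A (T k x) ^+ 2 <= c.
    have [_ [c c0 Tc]] := HT k; exists (c ^+ 2) => x Sx.
    rewrite ler_pXn2r ?nnegrE ?A_norm_ge0 ?(ltW c0) //.
    by apply: le_trans (Tc x) _; rewrite Sx mulr1.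
  by exists (\sum_k c k) => x Sx; apply: ler_sum => k _; exact: Tc.
have bounded (f : H -> R) c : 0 <= c -> (forall x, S x -> f x <= c * m x) ->
    has_ubound [set Num.sqrt (f x) | x in S]%classic.
  move=> c0 fm; exists (Num.sqrt (c * B)) => _ [x Sx <-].
  by rewrite ler_wsqrtr // (le_trans (fm _ Sx)) // ler_wpM2l // mB.
pose w := sup [set Num.sqrt (p x) | x in S]%classic.
pose J := sup [set Num.sqrt (m x) | x in S]%classic.
pose N := sup [set Num.sqrt (g x) | x in S]%classic.
have -> : A_joint_numerical_radius dot A T = w by [].
have -> : A_joint_norm dot A T = J by [].
have -> : A_alpha_beta_norm dot A alpha beta T = N.
  rewrite /A_alpha_beta_norm /N; congr (sup (image _ _)).
  by apply/funext => x; rewrite /g /p /m !mulr_sumr -big_split.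
have w0 : 0 <= w by apply: sup_image_ge0 => x; exact: sqrtr_ge0.
have J0 : 0 <= J by apply: sup_image_ge0 => x; exact: sqrtr_ge0.
have N0 : 0 <= N by apply: sup_image_ge0 => x; exact: sqrtr_ge0.
have pw x : S x -> Num.sqrt (p x) <= w.
  apply: le_sup_image; apply: (bounded _ 1) => // y Sy.
  by rewrite mul1r pm.
have mJ x : S x -> Num.sqrt (m x) <= J.
  by apply: le_sup_image; apply: (bounded _ 1) => // y Sy; rewrite mul1r.
have gN x : S x -> Num.sqrt (g x) <= N.
  by apply: le_sup_image; apply: (bounded _ (alpha + beta)).
have pw2 x : S x -> p x <= w ^+ 2.
  move=> Sx; rewrite -(sqr_sqrtr (p0 x)).
  by rewrite ler_pXn2r ?nnegrE ?sqrtr_ge0 // pw.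
have mw2 x : S x -> m x <= 4 * n%:R * w ^+ 2.
  move=> Sx; have Tw k : A_norm dot A (T k x) ^+ 2 <= 4 * w ^+ 2.
    have := A_norm_le_radius _ _ _ _ HApos (T k) w x w0.
    rewrite Sx expr1n mulr1; apply=> y Sy; apply: le_trans (pw y Sy).
    rewrite -[leLHS]ger0_norm ?normc_ge0 // -sqrtr_sqr ler_wsqrtr //.
    (* A single summand is at most the whole sum [p], so the joint radius [w] bounds the numerical
       radius of each [T k]. *)
    by rewrite /p (bigD1 k) //= lerDl sumr_ge0 // => j _; exact: sqr_ge0.
  apply: le_trans (ler_sum _ (fun k _ => Tw k)) _.
  by rewrite sumr_const card_ord -[leLHS]mulr_natr mulrAC.
have sqrt_le a c y : 0 <= y -> 0 <= c -> a <= c * y ^+ 2 ->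
    Num.sqrt a <= Num.sqrt c * y.
  move=> y0 c0 h; rewrite -(ger0_norm y0) -sqrtr_sqr -sqrtrM //.
  exact: ler_wsqrtr.
have wN : Num.sqrt (alpha + beta) * w <= N.
  apply: mul_sup_image_le; rewrite ?sqrtr_ge0 // => x Sx.
  by rewrite -sqrtrM //; apply: le_trans (gN x Sx); rewrite ler_wsqrtr ?pg.
have JN : J <= 2 * Num.sqrt n%:R * w.
  have -> : 2 * Num.sqrt n%:R = Num.sqrt (4 * n%:R) :> R.
    rewrite sqrtrM // -[4]/((2 * 2)%N%:R) natrM -expr2 sqrtr_sqr.
    by rewrite ger0_norm.
  apply: sup_image_le => [|x Sx]; first by rewrite mulr_ge0 ?sqrtr_ge0.
  by apply: sqrt_le => //; rewrite ?mw2 // mulr_ge0 ?ler0n.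
split; apply/andP; split.
- exact: wN.
- apply: sup_image_le => [|x Sx]; first by rewrite mulr_ge0 ?sqrtr_ge0.
  apply: sqrt_le => //; first by rewrite addr_ge0 // !mulr_ge0 ?ler0n.
  rewrite mulrDl lerD ?ler_wpM2l ?pw2 //.
  have -> : 4 * beta * n%:R * w ^+ 2 = beta * (4 * n%:R * w ^+ 2) by ring.
  by rewrite ler_wpM2l ?mw2.
- case: (leP (Num.sqrt beta)) => _.
    (* By [JN] the factor sqrt n cancels, leaving sqrt (alpha + beta) w, which [wN] bounds by
       [N]. *)
    rewrite -mulrA -ler_pdivlMl ?invr_gt0 // invrK.
    apply: le_trans (ler_wpM2l (sqrtr_ge0 _) JN) _.
    have -> : Num.sqrt ((alpha + beta) / n%:R) * (2 * Num.sqrt n%:R * w)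
        = 2 * (Num.sqrt ((alpha + beta) / n%:R) * Num.sqrt n%:R * w) by ring.
    rewrite -sqrtrM ?divr_ge0 // divfK ?gt_eqF //.
    by rewrite ler_wpM2l.
  (* For the constant sqrt beta, drop the nonnegative term alpha p from [g]. *)
  apply: mul_sup_image_le; rewrite ?sqrtr_ge0 // => x Sx.
  rewrite -sqrtrM //; apply: le_trans (gN x Sx); rewrite ler_wsqrtr //.
  by rewrite /g lerDr mulr_ge0.
- apply: sup_image_le => [|x Sx]; first by rewrite mulr_ge0 ?sqrtr_ge0.
  apply: le_trans (ler_wsqrtr (gm x Sx)) _; rewrite sqrtrM //.
  by rewrite ler_wpM2l ?sqrtr_ge0 ?mJ.
Qed.
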